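(* Let $G=(V,E)$ be a transient graph that is connected, simple, and locally finite, with a fixed vertex $o$ and a fixed rotor mechanism $(m_x)_{x\in V}$. If $\rho_{\min}$ is a rotor configuration such that, for every vertex $x\in V$ and every outgoing edge $(x,y)$ of $x$, \[ w(\rho_{\min}(x))\leq w(x,y), \] then \[ \lim_{n\to\infty}\frac{I(\rho_{\min},n)}{n}=\alpha_G. \]
   Context: $G=(V,E)$ is connected, simple (no loops or multiple edges), locally finite, and $o\in V$ is a fixed vertex. For $x\in V$, $\mathcal{E}_x$ is the set of outgoing directed edges $(x,y)$ with $y$ a neighbor of $x$ (written $y\sim x$), and $\deg(x)=|\mathcal{E}_x|$. A rotor mechanism is a choice, for each $x$, of a bijection $m_x:\mathcal{E}_x\to\mathcal{E}_x$ having exactly one orbit. A rotor configuration is a map $\rho$ assigning to each $x\in V$ an edge $\rho(x)\in\mathcal{E}_x$. $\mathcal{G}(x)$ (the Green function) is the expected number of visits to $x$ by simple random walk on $G$ started at $o$ (finite since $G$ is transient). $\alpha_G$ is the probability that simple random walk started at $o$ never returns to $o$. Weight of a directed edge $(x,y)$: writing $(x,y_i):=m_x^i(x,y)$ (the edge obtained from $(x,y)$ by applying $m_x$ $i$ times), \[ w(x,y):=\frac{-1}{\deg(x)}\sum_{i=0}^{\deg(x)-1} i\,\frac{\mathcal{G}(y_{i+1})}{\deg(y_{i+1})}. \] Experiment: given an initial rotor configuration $\rho$ and $n\geq1$, define particle positions $X_t^{(0)},\dots,X_t^{(n-1)}$ and configurations $\rho_t$ for $t\ge 0$ by: $X_0^{(i)}=o$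 for all $i$ and $\rho_0=\rho$. Let $i_t:=t+1 \bmod n$. Particle $i$ is said to have returned to $o$ by time $t$ if $X_t^{(i)}=o$ and $X_s^{(i)}\neq o$ for some $s<t$. If particle $i_t$ has returned to $o$ by time $t$, then $\rho_{t+1}=\rho_t$ and $X_{t+1}^{(i)}=X_t^{(i)}$ for all $i$. Otherwise, $\rho_{t+1}(x)=m_x(\rho_t(x))$ if $x=X_t^{(i_t)}$ and $\rho_{t+1}(x)=\rho_t(x)$ otherwise; $X_{t+1}^{(i_t)}$ is the target vertex of the edge $\rho_{t+1}(X_t^{(i_t)})$, and $X_{t+1}^{(i)}=X_t^{(i)}$ for $i\neq i_t$. $I(\rho,n)$ denotes the number of particles $i\in\{0,\dots,n-1\}$ that never return to $o$. *)

(* Defs.v *)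
From HB Require Import structures.
From mathcomp Require Import all_boot all_order all_algebra.
From mathcomp Require Import all_classical all_reals all_analysis.
Set Implicit Arguments. Unset Strict Implicit. Unset Printing Implicit Defensive.
Import Order.TTheory GRing.Theory Num.Theory.
Import numFieldNormedType.Exports.
Local Open Scope ring_scope.

(* A graph on vertex type V is given by its neighbour lists nb x (finite:
   locally finite).  The outgoing edge (x,y) is represented by the
   neighbour y \in nb x. *)
Section RotorDefs.
Variables (R : realType) (V : eqType) (nb : V -> seq V) (o : V).

Definition deg (x : V) : nat := size (nb x).

Definition simple_graph : Prop :=
  [/\ forall x, uniq (nb x),
      forall x, x \notin nb x
    & forall x y, (y \in nb x) = (x \in nb y)].

Definition connected_graph : Prop :=
  forall x y, exists p : seq V, path (fun a b => b \in nb a) x p /\ last x p = y.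

(* srw t y = P_o(X_t = y) for simple random walk started at o *)
Fixpoint srw (t : nat) (y : V) : R :=
  match t with
  | 0 => (y == o)%:R
  | t'.+1 => \sum_(x <- nb y) srw t' x / (deg x)%:R
  end.

Definition transient : Prop := cvgn (series (fun t => srw t o)).

Definition green (y : V) : R := limn (fun N => \sum_(0 <= t < N) srw t y).

(* taboo t y = P_o(X_t = y and X_s <> o for all 1 <= s < t);
   for t >= 1, taboo t o = P_o(first return to o happens at time t) *)
Fixpoint taboo (t : nat) (y : V) : R :=
  match t with
  | 0 => (y == o)%:R
  | t'.+1 => \sum_(x <- nb y | (t' == 0)%N || (x != o)) taboo t' x / (deg x)%:R
  end.

Definition escape_prob : R := 1 - limn (fun N => \sum_(1 <= t < N) taboo t o).

Definition rotor_mechanism (m : V -> V -> V) : Prop :=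
  forall x,
    [/\ {in nb x, forall y, m x y \in nb x},
        {in nb x &, injective (m x)}
      & {in nb x &, forall y z, exists k, iter k (m x) y = z}].

Definition rotor_config (rho : V -> V) : Prop := forall x, rho x \in nb x.

Definition weight (m : V -> V -> V) (x y : V) : R :=
  - (deg x)%:R^-1 *
    \sum_(i < deg x)
       (i%:R * green (iter i.+1 (m x) y) / (deg (iter i.+1 (m x) y))%:R).

Record state := State {
  rot : V -> V;
  pos : nat -> V;
  left_o : nat -> bool   (* left_o i = exists s < t, X_s^(i) != o *)
}.

Definition init_state (rho : V -> V) : state :=
  State rho (fun _ => o) (fun _ => false).

Definition returned_st (s : state) (i : nat) : bool :=
  (pos s i == o) && left_o s i.

Definition step (m : V -> V -> V) (n t : nat) (s : state) : state :=
  let i := (t.+1 %% n)%N in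
  let newleft := fun j => left_o s j || (pos s j != o) in
  if returned_st s i then State (rot s) (pos s) newleft
  else
    let x := pos s i in
    let r' := fun z => if z == x then m x (rot s x) else rot s z in
    State r' (fun j => if j == i then r' x else pos s j) newleft.

Fixpoint traj (m : V -> V -> V) (rho : V -> V) (n t : nat) : state :=
  match t with
  | 0 => init_state rho
  | t'.+1 => step m n t' (traj m rho n t')
  end.

Definition X (m : V -> V -> V) (rho : V -> V) (n t i : nat) : V :=
  pos (traj m rho n t) i.

Definition never_returns (m : V -> V -> V) (rho : V -> V) (n i : nat) : Prop :=
  ~ (exists t, X m rho n t i = o /\ exists s, (s < t)%N /\ X m rho n s i <> o).

Definition I_count (m : V -> V -> V) (rho : V -> V) (n : nat) : nat :=
  count (fun i => `[< never_returns m rho n i >]) (iota 0 n).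

End RotorDefs.

(* Main.v *)
Require Import Defs.
From HB Require Import structures.
From mathcomp Require Import all_boot all_order all_algebra.
From mathcomp Require Import all_classical all_reals all_analysis.
From mathcomp Require Import ring lra.
Set Implicit Arguments. Unset Strict Implicit. Unset Printing Implicit Defensive.
Import Order.TTheory GRing.Theory Num.Theory.
Import numFieldNormedType.Exports.
Local Open Scope classical_set_scope.
Local Open Scope ring_scope.

(* Put g = G/deg, which averages to g over the neighbours of each vertex other
   than o, and to g - 1/deg o at o.  Turning the rotor at x to y changes w(rotor)
   by (mean of g around x) - g y, so that one step of a particle changes the
   potential  sum_i g(X_i) + sum_x w(rotor at x)  by -1/deg o if it leaves o and
   by 0 otherwise.  Every particle leaves o exactly once.  When the initial
   rotors have minimal weight, the rotor part can only grow, and comparing the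
   potentials at time 0 and at late times gives I(n)/n >= 1/G(o), which is the
   escape probability by the renewal equation.

   For the reverse bound, replace G by its truncation G_N (expected number of
   visits before time N).  It has finite support and its potential changes by at
   least -1/deg o and 0 respectively, while the rotor part is bounded by some C_N
   independent of n.  Each vertex is left only finitely often, so the particles
   that never return end up outside the support, whence
   I(n)/n <= 1/G_N(o) + C_N'/n. *)

(** * Rotor weights and the effect of one rotor turn *)

Section RotorWeight.
Context {R : realType} {V : eqType}.
Variables (nb : V -> seq V) (m : V -> V -> V).
Hypotheses (nb_uniq : forall x, uniq (nb x)) (m_mech : rotor_mechanism nb m).
Implicit Types (x y z : V) (f : V -> R).

Definition mean f x : R := (\sum_(y <- nb x) f y) / (deg nb x)%:R.

(** For [f] equal to [green] over [deg] this is [weight]; a general [f] also covers the truncated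
    Green functions. *)
Definition rotor_weight f x y : R :=
  - (deg nb x)%:R^-1 * \sum_(i < deg nb x) (i%:R * f (iter i.+1 (m x) y)).

Lemma rotor_mem x y : y \in nb x -> m x y \in nb x.
Proof. by case: (m_mech x) => + _ _; apply. Qed.

Lemma iter_rotor_mem x y k : y \in nb x -> iter k (m x) y \in nb x.
Proof. by move=> yx; elim: k => //= k; exact: rotor_mem. Qed.

(** Let [q.+1] be the first return time of [y] under [m x]. Up to then the orbit has no repetition
    by minimality and exhausts [nb x] by transitivity, so [q.+1] is the degree. *)
Lemma rotor_orbit x y : y \in nb x ->
  perm_eq (traject (m x) y (deg nb x)) (nb x) /\ iter (deg nb x) (m x) y = y.
Proof.
move=> yx; have [_ _ trans] := m_mech x.
have [k0 k0E] := trans _ _ (rotor_mem yx) yx.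
have exP : exists q, iter q.+1 (m x) y == y.
  by exists k0; rewrite iterSr k0E.
pose q := ex_minn exP.
have [qE qmin] : iter q.+1 (m x) y = y /\
    forall i, iter i.+1 (m x) y = y -> (q <= i)%N.
  rewrite /q; case: ex_minnP => q' /eqP q'E q'min; split=> // i iE.
  by apply: q'min; rewrite iE.
have lq : looping (m x) y q.+1 by rewrite /looping qE mem_head.
have pe : perm_eq (traject (m x) y q.+1) (nb x).
  apply: uniq_perm => //.
    (* A repetition would give [iter q = iter i] at [y] with [i < q]; one more turn then leads back
       to [y] at time [i.+1], too early. *)
    rewrite looping_uniq; apply/negP => /trajectP[i iq iE].
    have /qmin : iter i.+1 (m x) y = y by rewrite iterS -iE -iterS.
    by rewrite leqNgt iq.
  move=> z; apply/idP/idP.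
    by case/trajectP=> i _ ->; exact: iter_rotor_mem.
  by move=> /(trans _ _ yx)[k <-]; move/loopingP: lq; apply.
have -> : deg nb x = q.+1 by rewrite /deg -(perm_size pe) size_traject.
by [].
Qed.

Lemma sum_orbit f x y : y \in nb x ->
  \sum_(i < deg nb x) f (iter i (m x) y) = \sum_(z <- nb x) f z.
Proof.
move=> yx; have [pe _] := rotor_orbit yx.
rewrite -(perm_big _ pe) /= (big_nth y) size_traject big_mkord.
apply: eq_bigr => i _; by rewrite nth_traject.
Qed.

(** Write [i] as [(i + 1) - 1] and shift the index. It is needed because turning a rotor shifts its
    orbit by one place. *)
Lemma summation_by_shift (a : nat -> R) d :
  \sum_(i < d) i%:R * a i.+1 =
  \sum_(i < d) i%:R * a i + d%:R * a d - \sum_(i < d) a i.+1.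
Proof.
elim: d => [|d IH]; first by rewrite !big_ord0 mul0r addr0 subr0.
by rewrite !big_ord_recr /= IH -natr1; ring.
Qed.

Lemma rotor_weight_turn f x y : y \in nb x ->
  rotor_weight f x (m x y) - rotor_weight f x y = mean f x - f (m x y).
Proof.
move=> yx; have myx := rotor_mem yx.
have dpos : (deg nb x)%:R != 0 :> R.
  by rewrite pnatr_eq0 /deg; case: (nb x) yx.
rewrite /rotor_weight /mean.
pose a i := f (iter i.+1 (m x) y).
have -> : \sum_(i < deg nb x) i%:R * f (iter i.+1 (m x) (m x y)) =
          \sum_(i < deg nb x) i%:R * a i.+1.
  by apply: eq_bigr => i _; rewrite /a [in RHS]iterSr.
rewrite summation_by_shift.
(* After a full cycle [a (deg nb x)] wraps round to [a 0]. *)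
have -> : a (deg nb x) = f (m x y).
  by rewrite /a iterS; have [_ ->] := rotor_orbit yx.
have -> : \sum_(i < deg nb x) a i.+1 = \sum_(z <- nb x) f z.
  rewrite -(sum_orbit f (rotor_mem myx)).
  by apply: eq_bigr => i _; rewrite /a !iterSr.
rewrite -/(a _); field.
exact: dpos.
Qed.

End RotorWeight.

Lemma eventually_all (I : eqType) (s : seq I) (P : nat -> I -> Prop) :
  {in s, forall x, exists T, forall t, (T <= t)%N -> P t x} ->
  exists T, forall t, (T <= t)%N -> {in s, forall x, P t x}.
Proof.
elim: s => [|x s IH] Ps; first by exists 0%N.
have [T1 P1] := Ps x (mem_head _ _).
have [|T2 P2] := IH; first by move=> y ys; apply: Ps; rewrite inE ys orbT.
exists (maxn T1 T2) => t; rewrite geq_max => /andP[t1 t2] y.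
by rewrite inE => /predU1P[->|]; [exact: P1 | exact: P2].
Qed.

(** * The rotor walk of [n] particles and its potential *)

Section RotorWalk.
Context {R : realType} {V : eqType}.
Variables (nb : V -> seq V) (o : V) (m : V -> V -> V) (rho : V -> V).
Variable (n : nat).
Hypotheses (nb_simple : simple_graph nb) (m_mech : rotor_mechanism nb m).
Hypotheses (rho_conf : rotor_config nb rho) (n_gt0 : (0 < n)%N).
Implicit Types (x y z : V) (t i : nat) (f : V -> R).

Let st t := traj o m rho n t.
Let turn t := (t.+1 %% n)%N.

Definition active t := ~~ returned_st o (traj o m rho n t) (t.+1 %% n).
Definition mover t := pos (traj o m rho n t) (t.+1 %% n).
Definition target t := m (mover t) (Defs.rot (traj o m rho n t) (mover t)).
Definition departs t x := active t && (mover t == x).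

Lemma posS t i : pos (st t.+1) i =
  if active t && (i == turn t) then target t else pos (st t) i.
Proof.
rewrite /active /st /= /step -/(st t) -/(turn t).
by case: ifP => //= _; rewrite /target /mover eqxx.
Qed.

Lemma rotS t x : Defs.rot (st t.+1) x =
  if departs t x then m x (Defs.rot (st t) x) else Defs.rot (st t) x.
Proof.
rewrite /departs /active /st /= /step -/(st t) -/(turn t).
by case: ifP => //= _; rewrite /mover eq_sym; case: eqP => // ->.
Qed.

Lemma left_oS t i :
  left_o (st t.+1) i = left_o (st t) i || (pos (st t) i != o).
Proof. by rewrite /st /= /step; case: ifP. Qed.

Lemma turn_lt t : (turn t < n)%N. Proof. by rewrite ltn_mod. Qed.

Lemma rot_mem t x : Defs.rot (st t) x \in nb x.
Proof.
elim: t => [|t IH]; first exact: rho_conf.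
by rewrite rotS; case: ifP => // _; exact: (rotor_mem m_mech).
Qed.

Lemma target_mem t : target t \in nb (mover t).
Proof. exact/(rotor_mem m_mech)/rot_mem. Qed.



Definition potential f (c : R) (S : seq V) t : R :=
  \sum_(i < n) (f (pos (traj o m rho n t) i)
                + c * (left_o (traj o m rho n t.+1) i)%:R)
  + \sum_(x <- S) rotor_weight nb m f x (Defs.rot (traj o m rho n t) x).

Lemma potential0 f c S :
  potential f c S 0 = n%:R * f o + \sum_(x <- S) rotor_weight nb m f x (rho x).
Proof.
rewrite /potential; congr (_ + _).
rewrite (eq_bigr (fun=> f o)) => [|i _].
  by rewrite sumr_const card_ord mulr_natl.
by rewrite -/(st 1) left_oS /= eqxx /= mulr0 addr0.
Qed.

Lemma target_neq t : target t != mover t.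
Proof.
have [_ irr _] := nb_simple.
by apply: contraNneq (irr (mover t)) => {1}<-; exact: target_mem.
Qed.

(** A move from [x] to [y] changes the particle term by [f y - f x] and the rotor weight at [x] by
    [mean nb f x - f y], so [f y] cancels. *)
Lemma potentialS f c S t : uniq S -> (active t -> mover t \in S) ->
  potential f c S t.+1 = potential f c S t +
    (if active t then
       mean nb f (mover t) - f (mover t) + c * (mover t == o)%:R else 0).
Proof.
move=> uS inS; rewrite /potential -!/(st _).
case: ifPn => [act|nact]; last first.
  rewrite addr0; congr (_ + _); apply: eq_bigr => i _.
    rewrite posS (negPf nact) /= left_oS posS (negPf nact) /= left_oS.
    by rewrite -orbA orbb.
  by rewrite rotS /departs (negPf nact).
have xS := inS act.
rewrite (bigD1 (Ordinal (turn_lt t))) //= [in RHS](bigD1 (Ordinal (turn_lt t))) //=.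
rewrite (bigD1_seq (mover t)) //= [in RHS](bigD1_seq (mover t)) //=.
have -> : \sum_(i < n | i != Ordinal (turn_lt t))
    (f (pos (st t.+1) i) + c * (left_o (st t.+2) i)%:R) =
  \sum_(i < n | i != Ordinal (turn_lt t))
    (f (pos (st t) i) + c * (left_o (st t.+1) i)%:R).
  apply: eq_bigr => i it.
  have it' : (i == turn t :> nat) = false.
    by apply: contraNF it => /eqP it; apply/eqP/val_inj.
  by rewrite left_oS posS it' andbF left_oS -orbA orbb.
have -> : \sum_(x <- S | x != mover t) rotor_weight nb m f x (Defs.rot (st t.+1) x) =
          \sum_(x <- S | x != mover t) rotor_weight nb m f x (Defs.rot (st t) x).
  apply: eq_bigr => x xt; rewrite rotS /departs eq_sym (negPf xt) andbF //.
(* An active particle standing at [o] has never left it, and its target is not [o] since there are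
   no loops: the flag flips exactly at a departure from [o]. *)
have turnE : (left_o (st t.+2) (turn t))%:R =
  (left_o (st t.+1) (turn t))%:R + (mover t == o)%:R :> R.
  rewrite left_oS posS act eqxx /= left_oS -/(mover t).
  have := target_neq t; move: act; rewrite /active /returned_st -/(mover t).
  case: eqP => [->|_] /=; last by rewrite orbT addr0.
  by move=> /negPf ->/= ->; rewrite add0r.
rewrite turnE posS act eqxx /= rotS /departs act eqxx /=.
have := rotor_weight_turn (fun x => let: And3 u _ _ := nb_simple in u x) m_mech f
  (rot_mem t (mover t)).
rewrite -/(target t) -/(mover t) => /eqP; rewrite subr_eq => /eqP ->.
ring.
Qed.

Lemma potential_sum f c S t : uniq S ->
  (forall s, (s < t)%N -> active s -> mover s \in S) ->
  potential f c S t = potential f c S 0 +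
    \sum_(s < t | active s)
       (mean nb f (mover s) - f (mover s) + c * (mover s == o)%:R).
Proof.
move=> uS; elim: t => [|t IH] inS; first by rewrite big_ord0 addr0.
rewrite potentialS ?IH//; last exact: inS.
  by rewrite big_mkcond [in RHS]big_mkcond /= big_ord_recr /= addrA.
by move=> s /ltnW st'; apply: inS.
Qed.

(** * Schedule of the turns and fate of a single particle *)

Lemma left_o_mono t t' i : (t <= t')%N -> left_o (st t) i -> left_o (st t') i.
Proof.
move=> /subnK <-; elim: (t' - t)%N => // k IH /IH.
by rewrite addSn left_oS => ->.
Qed.

Lemma returnedS t i : returned_st o (st t) i -> returned_st o (st t.+1) i.
Proof.
move=> ret; move: (ret) => /andP[/eqP po lo].
rewrite /returned_st left_oS lo andbT posS.
case: (i =P turn t) => [it|_]; last by rewrite andbF po eqxx.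
by rewrite /active -/(turn t) -it -/(st t) ret /= po eqxx.
Qed.

Lemma returned_mono t t' i : (t <= t')%N ->
  returned_st o (st t) i -> returned_st o (st t') i.
Proof.
move=> /subnK <-; elim: (t' - t)%N => // k IH /IH.
by rewrite addSn; exact: returnedS.
Qed.

Lemma waiting t i : i != turn t ->
  pos (st t.+1) i = pos (st t) i /\
  returned_st o (st t.+1) i = returned_st o (st t) i.
Proof.
move=> /negPf it; rewrite /returned_st posS it andbF left_oS.
by split=> //; case: eqP; rewrite ?orbF.
Qed.

Lemma next_turn t i : (i < n)%N -> exists k, i = turn (t + k).
Proof.
(* This makes [t + k + 1] equal to [t.+1 * n + i]; the subtraction does not truncate because [n] is
   positive. *)
move=> i_n; exists (t.+1 * n + i - t.+1)%N.
rewrite /turn -addSn subnKC ?modnMDl ?modn_small //.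
by rewrite (leq_trans _ (leq_addr _ _)) // leq_pmulr.
Qed.

Lemma waiting_until t k i : (forall j, (j < k)%N -> i != turn (t + j)) ->
  pos (st (t + k)) i = pos (st t) i /\
  returned_st o (st (t + k)) i = returned_st o (st t) i.
Proof.
elim: k => [|k IH] wait; first by rewrite addn0.
rewrite addnS; have [-> ->] := waiting (wait k (ltnSn k)).
by apply: IH => j jk; apply: wait; rewrite ltnS ltnW.
Qed.

(** The time is the next turn of particle [i], until which its position and its returned status do
    not change. *)
Lemma unreturned_departs t i : (i < n)%N -> ~~ returned_st o (st t) i ->
  exists2 t', (t <= t')%N & departs t' (pos (st t) i).
Proof.
move=> i_n nret.
have exk : exists k, i == turn (t + k).
  by have [k kE] := next_turn t i_n; exists k; apply/eqP.
case: (ex_minnP exk) => k /eqP kE kmin; exists (t + k)%N; first exact: leq_addr.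
have [|pE rE] := @waiting_until t k i.
  by move=> j jk; apply: contraL jk => /kmin; rewrite leqNgt.
by rewrite /departs /active /mover -/(turn _) -kE -/(st _) rE nret pE eqxx.
Qed.

(** * Every vertex is left only finitely often *)

Definition departs_forever x := forall T, exists2 t, (T <= t)%N & departs t x.

(** Take the first departure from [x] at or after [T]; nothing else turns the rotor at [x]. *)
Lemma next_departure x T : departs_forever x ->
  exists t, [/\ (T <= t)%N, departs t x & Defs.rot (st t) x = Defs.rot (st T) x].
Proof.
move=> inf.
have exk : exists k, departs (T + k) x.
  by have [t Tt dt] := inf T; exists (t - T)%N; rewrite subnKC.
case: (ex_minnP exk) => k dk kmin; exists (T + k)%N; split=> //.
  exact: leq_addr.
elim: k {dk exk} kmin => [|k IH] kmin; first by rewrite addn0.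
rewrite addnS rotS ifN; last by apply/negP => /kmin; rewrite ltnn.
by apply: IH => j /kmin /ltnW.
Qed.

(** Successive departures from [x] follow the cycle of [m x]. The induction is on the number of
    turns between the next target, [m x] of the current rotor, and [y]. *)
Lemma departs_toward x y T : departs_forever x -> y \in nb x ->
  exists t, [/\ (T <= t)%N, departs t x & target t = y].
Proof.
move=> inf yx; have [_ _ trans] := m_mech x.
have [k] := trans _ _ (rotor_mem m_mech (rot_mem T x)) yx.
elim: k T => [|k IH] T kE.
  have [t [Tt dt rE]] := next_departure T inf; exists t; split=> //.
  by rewrite /target; case/andP: dt => _ /eqP ->; rewrite -/(st t) rE.
have [t [Tt dt rE]] := next_departure T inf.
have [|t' [tt' dt' tE]] := IH t.+1.
  by rewrite rotS dt rE -[RHS]kE -iterSr.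
by exists t'; split=> //; apply: leq_trans (ltnW tt').
Qed.

(** A particle arriving at [y] away from [o] is not returned, so it has to leave [y] later. *)
Lemma departs_forever_neighbor x y :
  departs_forever x -> y \in nb x -> y != o -> departs_forever y.
Proof.
move=> inf yx yo T; have [t [Tt dt tE]] := departs_toward T inf yx.
have pE : pos (st t.+1) (turn t) = y.
  by rewrite posS eqxx andbT; case/andP: dt => -> _.
have [|t' tt'] := @unreturned_departs t.+1 (turn t) (turn_lt t).
  by rewrite /returned_st pE (negPf yo).
by rewrite pE => dt'; exists t' => //; apply: leq_trans (ltnW tt').
Qed.

Definition returned_count t := count (returned_st o (traj o m rho n t)) (iota 0 n).

Lemma returned_count_le t : (returned_count t <= n)%N.
Proof. by rewrite -[leqRHS](size_iota 0); exact: count_size. Qed.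

Lemma returned_countE t :
  returned_count t = (\sum_(i < n) returned_st o (traj o m rho n t) i)%N.
Proof.
rewrite /returned_count -sum1_count big_mkcond -[in iota 0 n](subn0 n).
by rewrite -/(index_iota 0 n) big_mkord; apply: eq_bigr => i _; case: ifP.
Qed.

Lemma returned_count_mono t t' :
  (t <= t')%N -> (returned_count t <= returned_count t')%N.
Proof. by move=> tt'; apply: sub_count => i; exact: returned_mono. Qed.

Lemma returned_countS t : active t -> target t = o ->
  (returned_count t < returned_count t.+1)%N.
Proof.
move=> act tE; rewrite !returned_countE.
rewrite (bigD1 (Ordinal (turn_lt t))) //=.
rewrite [X in (_ < X)%N](bigD1 (Ordinal (turn_lt t))) //=.
move: (act); rewrite /active => /negPf ->.
have -> : returned_st o (traj o m rho n t.+1) (turn t).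
  rewrite /returned_st -/(st _) posS act eqxx /= tE eqxx left_oS.
  by rewrite -tE eq_sym -/(mover t) target_neq orbT.
rewrite add0n add1n ltnS; apply: leq_sum => i _.
by case: (boolP (returned_st o (traj o m rho n t) i)) => // /returnedS ->.
Qed.

(** Each departure from [x] to [o] makes one more particle return, and there are only [n]
    particles. *)
Lemma not_departs_forever_neighbor_o x : o \in nb x -> ~ departs_forever x.
Proof.
move=> ox inf.
suff /(_ n.+1)[t] : forall k, exists t, (k <= returned_count t)%N.
  by rewrite ltnNge returned_count_le.
elim=> [|k [T kT]]; first by exists 0%N.
have [t [Tt /andP[act _] tE]] := departs_toward T inf ox; exists t.+1.
apply: leq_ltn_trans (returned_countS act tE).
exact/(leq_trans kT)/returned_count_mono.
Qed.

Hypothesis nb_conn : connected_graph nb.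

(** Infinitely many departures would spread along a path towards [o] until they reach a neighbour of
    [o]. *)
Lemma not_departs_forever x : ~ departs_forever x.
Proof.
have [_ irr sym] := nb_simple.
have [p [xp po]] := nb_conn x o.
(* For the empty path [x] is [o] itself, and the departures spread to its neighbour [rho o]. *)
elim: p x xp po => [|y p IH] x /= => [_ -> inf | /andP[yx yp] po inf].
  have yo := rho_conf o.
  apply: (@not_departs_forever_neighbor_o (rho o)); first by rewrite sym.
  apply: departs_forever_neighbor inf yo _.
  by apply: contraNneq (irr o) => {1}<-.
have [yo|yo] := eqVneq y o.
  by apply: (@not_departs_forever_neighbor_o x) inf; rewrite -yo.
exact: IH yp po (departs_forever_neighbor inf yx yo).
Qed.

(** From some time on no vertex of [D] is left any more, whereas an unreturned particle in [D] would
    still have to leave. *)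
Lemma eventually_outside (D : seq V) : exists T, forall t, (T <= t)%N ->
  forall i, (i < n)%N -> ~~ returned_st o (st t) i -> pos (st t) i \notin D.
Proof.
have [|T TP] := @eventually_all _ D (fun t x => ~~ departs t x).
  move=> x _; apply: contrapT => /forallNP nT.
  apply: (@not_departs_forever x) => T; have /existsNP[t /not_implyP[Tt]] := nT T.
  by move=> /negP/negPn dt; exists t.
exists T => t Tt i i_n nret; apply/negP => iD.
have [t' tt' dt'] := unreturned_departs i_n nret.
by have := TP _ (leq_trans Tt tt') _ iD; rewrite dt'.
Qed.

Lemma eventually_left : exists T, forall t, (T <= t)%N ->
  forall i, (i < n)%N -> left_o (st t) i.
Proof.
have [|T TP] := @eventually_all _ (iota 0 n) (fun t i => left_o (st t) i).
  (* At turn [k] particle [i] has returned, or is away from [o], or moves off [o]. The flag lags one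
     step behind the position, hence [k.+2]. *)
  move=> i; rewrite mem_iota => i_n; have [k kE] := next_turn 0 i_n.
  rewrite add0n in kE; exists k.+2 => t kt; apply: left_o_mono kt _.
  rewrite left_oS posS -kE eqxx andbT left_oS.
  have moverE : pos (st k) i = mover k by rewrite kE.
  case: ifPn => [act|]; last first.
    by rewrite /active negbK -/(turn k) -kE => /andP[_ ->].
  rewrite moverE; have [<-|mo] := eqVneq (mover k) o; last by rewrite orbT.
  by rewrite target_neq orbT.
by exists T => t Tt i i_n; apply: TP Tt _ _; rewrite mem_iota.
Qed.

Lemma left_oE t i : left_o (st t) i <-> exists s, (s < t)%N /\ pos (st s) i <> o.
Proof.
elim: t => [|t [IH1 IH2]]; first by split=> [|[s []]].
rewrite left_oS; split=> [/orP[/IH1[s [st' so]]|/eqP po]|[s [st' so]]].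
- by exists s; split=> //; exact: ltnW.
- by exists t.
- move: st'; rewrite ltnS leq_eqVlt => /predU1P[<-|st'].
    by move/eqP: so => ->; rewrite orbT.
  by rewrite IH2 //; exists s.
Qed.

Lemma never_returnsE i :
  never_returns o m rho n i <-> forall t, ~~ returned_st o (st t) i.
Proof.
split=> [nr t|nr [t [po lo]]].
  apply/negP => /andP[/eqP po /left_oE lo]; apply: nr; exists t; split=> //.
by have /negP[] := nr t; rewrite /returned_st -/(X o m rho n t i) po eqxx; apply/left_oE.
Qed.

(** A return is permanent, so the status of each of the [n] particles is eventually constant. *)
Lemma eventually_I_count : exists T, forall t, (T <= t)%N ->
  (I_count o m rho n + returned_count t = n)%N.
Proof.
have [|T TP] := @eventually_all _ (iota 0 n)
    (fun t i => returned_st o (st t) i = ~~ `[< never_returns o m rho n i >]).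
  move=> i _; have [nr|/never_returnsE/existsNP[T /negP/negPn ret]] :=
      pselect (never_returns o m rho n i).
    exists 0%N => t _; rewrite asboolT //=; apply: negbTE.
    by move/never_returnsE: nr.
  exists T => t Tt; rewrite (returned_mono Tt ret) asboolF //.
  by move=> /never_returnsE /(_ T); rewrite ret.
exists T => t Tt; rewrite /returned_count (eq_in_count (TP t Tt)).
by rewrite /I_count -[RHS](size_iota 0); exact: count_predC.
Qed.

(** * Bounds on the number of particles that never return *)

Let nb_uniq x : uniq (nb x). Proof. by case: nb_simple. Qed.

(** The potential is constant. At a late time the flags contribute [n * c], returned particles [f o]
    each, the others at least 0, and no rotor weight is below its initial value. *)
Lemma I_count_ge f c : (forall x, 0 <= f x) ->
  (forall x, mean nb f x - f x + c * (x == o)%:R = 0) ->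
  (forall x y, y \in nb x ->
     rotor_weight nb m f x (rho x) <= rotor_weight nb m f x y) ->
  n%:R * c <= (I_count o m rho n)%:R * f o.
Proof.
move=> f0 harm rho_min.
have [T1 left1] := eventually_left; have [T2 count2] := eventually_I_count.
pose t := maxn T1 T2.
have Icnt := count2 t (leq_maxr _ _).
pose S := undup [seq mover s | s <- iota 0 t].
have : potential f c S t = potential f c S 0.
  rewrite (@potential_sum f c S t) ?undup_uniq //.
    by rewrite big1 ?addr0.
  by move=> s st' _; rewrite mem_undup map_f // mem_iota.
rewrite potential0 /potential big_split /= => potE.
have leftE : \sum_(i < n) c * (left_o (traj o m rho n t.+1) i)%:R = n%:R * c.
  rewrite (eq_bigr (fun=> c)) ?sumr_const ?card_ord ?mulr_natl // => i _.
  by rewrite -/(st _) left1 ?mulr1 // (leq_trans (leq_maxl T1 T2)).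
have retE : (returned_count t)%:R * f o <=
    \sum_(i < n) f (pos (traj o m rho n t) i).
  rewrite returned_countE natr_sum mulr_suml; apply: ler_sum => i _.
  by case: (boolP (returned_st _ _ _)) => [/andP[/eqP -> _]|_]; rewrite ?mul1r ?mul0r.
have wE : \sum_(x <- S) rotor_weight nb m f x (rho x) <=
    \sum_(x <- S) rotor_weight nb m f x (Defs.rot (traj o m rho n t) x).
  by apply: ler_sum => x _; apply/rho_min/rot_mem.
have nE : n%:R * f o = (I_count o m rho n)%:R * f o + (returned_count t)%:R * f o.
  by rewrite -mulrDl -natrD Icnt.
lra.
Qed.

(** A crude bound that does not involve [n], so that the error disappears after division by [n]. *)
Definition weight_bound f x : R :=
  2 * \sum_(z <- nb x) `|rotor_weight nb m f x z|.

Lemma rotor_weight_sub_le f x y z : y \in nb x -> z \in nb x ->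
  rotor_weight nb m f x y - rotor_weight nb m f x z <= weight_bound f x.
Proof.
have le u : u \in nb x -> `|rotor_weight nb m f x u| <=
    \sum_(z <- nb x) `|rotor_weight nb m f x z|.
  by move=> ux; rewrite (bigD1_seq u) //= lerDl sumr_ge0.
move=> /le yx /le zx; rewrite (le_trans (ler_norm _)) //.
by rewrite (le_trans (ler_normB _ _)) // /weight_bound mulrDl mul1r lerD.
Qed.

Lemma rotor_weight_eq0 f (D : seq V) x y : (forall z, z \notin D -> f z = 0) ->
  x \notin flatten [seq nb z | z <- D] -> y \in nb x -> rotor_weight nb m f x y = 0.
Proof.
have [_ _ sym] := nb_simple.
move=> f0 xD yx; rewrite /rotor_weight big1 ?mulr0 // => i _.
rewrite f0 ?mulr0 //; apply: contra xD => zD; apply/flattenP.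
eexists; first exact: map_f zD.
by rewrite -sym; exact: (iter_rotor_mem m_mech).
Qed.

(** The potential never decreases. At a late time unreturned particles lie outside [D] and
    contribute 0, the flags contribute at most [n * c], and only rotors at neighbours of [D] have
    nonzero weight. *)
Lemma I_count_le f c (D : seq V) : 0 <= c ->
  (forall z, z \notin D -> f z = 0) ->
  (forall x, 0 <= mean nb f x - f x + c * (x == o)%:R) ->
  (I_count o m rho n)%:R * f o <= n%:R * c +
    \sum_(x <- undup (flatten [seq nb z | z <- D])) weight_bound f x.
Proof.
move=> c0 fD sub.
have [T1 out1] := eventually_outside D; have [T2 count2] := eventually_I_count.
pose t := maxn T1 T2.
have Icnt := count2 t (leq_maxr _ _).
set N := flatten _.
(* Including [N] makes the part of [S] inside [N] a permutation of [undup N], whatever [t] is. *)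
pose S := undup ([seq mover s | s <- iota 0 t] ++ N).
have : potential f c S 0 <= potential f c S t.
  rewrite (@potential_sum f c S t) ?undup_uniq //.
    by rewrite lerDl sumr_ge0.
  by move=> s st' _; rewrite mem_undup mem_cat map_f // mem_iota.
rewrite potential0 /potential big_split /= => potE.
have leftE : \sum_(i < n) c * (left_o (traj o m rho n t.+1) i)%:R <= n%:R * c.
  rewrite mulr_natl -[n in leRHS](card_ord n) -sumr_const; apply: ler_sum => i _.
  by case: left_o; rewrite ?mulr1 ?mulr0.
have retE : \sum_(i < n) f (pos (traj o m rho n t) i) = (returned_count t)%:R * f o.
  rewrite returned_countE natr_sum mulr_suml; apply: eq_bigr => i _.
  case: (boolP (returned_st _ _ _)) => [/andP[/eqP -> _]|nret].
    by rewrite mul1r.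
  by rewrite mul0r fD // out1 // leq_maxl.
have wE : \sum_(x <- S) rotor_weight nb m f x (Defs.rot (traj o m rho n t) x) -
    \sum_(x <- S) rotor_weight nb m f x (rho x) <= \sum_(x <- undup N) weight_bound f x.
  rewrite -sumrB (bigID (mem N)) /= [X in _ + X]big1 ?addr0; last first.
    by move=> x xN; rewrite !(rotor_weight_eq0 fD) ?subrr //; exact: rot_mem.
  rewrite -big_filter (perm_big (undup N)) /=.
    by apply: ler_sum => x _; apply: rotor_weight_sub_le => //; exact: rot_mem.
  apply: uniq_perm; rewrite ?filter_uniq ?undup_uniq // => x.
  by rewrite mem_filter !mem_undup mem_cat; case: (x \in N); rewrite ?orbT ?andbF.
have nE : n%:R * f o = (I_count o m rho n)%:R * f o + (returned_count t)%:R * f o.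
  by rewrite -mulrDl -natrD Icnt.
lra.
Qed.

End RotorWalk.

(** * The Green function, its truncations and the escape probability *)

Section GreenFunction.
Context {R : realType} {V : eqType}.
Variables (nb : V -> seq V) (o : V).
Hypotheses (nb_simple : simple_graph nb) (deg_gt0 : forall x, (0 < deg nb x)%N).
Implicit Types (x y z : V) (s t N : nat).

Let degR_gt0 x : 0 < (deg nb x)%:R :> R. Proof. by rewrite ltr0n. Qed.

Definition partial_green N y : R := \sum_(0 <= t < N) srw R nb o t y.

Lemma srw_ge0 t y : 0 <= srw R nb o t y.
Proof.
elim: t y => [|t IH] y /=; first exact: ler0n.
by apply: sumr_ge0 => x _; rewrite divr_ge0.
Qed.

Lemma taboo_ge0 t y : 0 <= taboo R nb o t y.
Proof.
elim: t y => [|t IH] y /=; first exact: ler0n.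
by apply: sumr_ge0 => x _; rewrite divr_ge0.
Qed.

Lemma partial_greenS N y : partial_green N.+1 y =
  (y == o)%:R + \sum_(x <- nb y) partial_green N x / (deg nb x)%:R.
Proof.
rewrite /partial_green big_nat_recl //=; congr (_ + _).
rewrite exchange_big /=; apply: eq_bigr => x _.
by rewrite mulr_suml.
Qed.

Lemma partial_green_ge0 N y : 0 <= partial_green N y.
Proof. by apply: sumr_ge0 => t _; exact: srw_ge0. Qed.

Lemma partial_green_nd y : nondecreasing_seq (partial_green ^~ y).
Proof.
apply/nondecreasing_seqP => N.
by rewrite /partial_green big_nat_recr //= lerDl srw_ge0.
Qed.

(** The one-step recursion turns the mean into the truncation at [N.+1]; the defect is the single
    extra term at time [N], which is nonnegative. *)
Lemma mean_partial_green N x :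
  mean nb (fun z => partial_green N z / (deg nb z)%:R) x
  - partial_green N x / (deg nb x)%:R + (deg nb o)%:R^-1 * (x == o)%:R =
  srw R nb o N x / (deg nb x)%:R.
Proof.
have -> : srw R nb o N x = partial_green N.+1 x - partial_green N x.
  by rewrite /partial_green big_nat_recr //=; ring.
rewrite partial_greenS /mean.
have -> : (deg nb o)%:R^-1 * (x == o)%:R = (deg nb x)%:R^-1 * (x == o)%:R :> R.
  by case: eqP => [->|_]; rewrite ?mulr0.
by ring.
Qed.

Lemma srw_finite_support N : exists D : seq V,
  forall t, (t < N)%N -> forall y, y \notin D -> srw R nb o t y = 0.
Proof.
have [_ _ sym] := nb_simple.
have supp t : exists D : seq V, forall y, y \notin D -> srw R nb o t y = 0.
  elim: t => [|t [D DP]].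
    by exists [:: o] => y /=; rewrite inE => /negPf ->.
  exists (flatten [seq nb z | z <- D]) => y yD /=.
  rewrite big_seq big1 // => x xy; rewrite DP ?mul0r //.
  apply: contra yD => xD; apply/flattenP.
  by eexists; [exact: map_f xD | rewrite sym].
elim: N => [|N [D DP]]; first by exists [::].
have [D' D'P] := supp N; exists (D ++ D') => t.
rewrite ltnS leq_eqVlt => tN y; rewrite mem_cat negb_or => /andP[yD yD'].
by case/predU1P: tN => [->|tN]; [exact: D'P | exact: DP].
Qed.

Lemma partial_green_finite_support N : exists D : seq V,
  forall y, y \notin D -> partial_green N y = 0.
Proof.
have [D DP] := srw_finite_support N; exists D => y yD.
by rewrite /partial_green big_nat big1 // => t /andP[_ tN]; exact: DP.
Qed.

Hypotheses (nb_conn : connected_graph nb) (nb_trans : transient R nb o).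

(** Transience is convergence at [o]. It passes from [x] to a neighbour [z] because the recursion
    bounds [partial_green N z] by [deg z] times [partial_green N.+1 x]. *)
Lemma cvg_partial_green y : cvgn (partial_green ^~ y).
Proof.
suff gen p x : path (fun a b => b \in nb a) x p ->
    cvgn (partial_green ^~ x) -> cvgn (partial_green ^~ (last x p)).
  by have [p [op <-]] := nb_conn o y; apply: gen op _; exact: nb_trans.
elim: p x => [//|z p IH] x /= /andP[zx zp] cx.
apply: IH zp _; apply: nondecreasing_is_cvgn; first exact: partial_green_nd.

have u := let: And3 u _ _ := nb_simple in u x.
exists ((deg nb z)%:R * limn (partial_green ^~ x)) => _ [N _ <-].
rewrite mulrC -ler_pdivrMr //.
apply: le_trans (nondecreasing_cvgn_le (partial_green_nd x) cx N.+1).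
rewrite partial_greenS (bigD1_seq z) //= addrCA lerDl addr_ge0 ?ler0n //.
by apply: sumr_ge0 => w _; rewrite divr_ge0 ?partial_green_ge0.
Qed.

Lemma green_ge0 y : 0 <= green R nb o y.
Proof.
apply: limr_ge; first exact: cvg_partial_green.
by near=> N; exact: partial_green_ge0.
Unshelve. all: by end_near. Qed.

Lemma green_eq y :
  green R nb o y = (y == o)%:R + \sum_(x <- nb y) green R nb o x / (deg nb x)%:R.
Proof.
have cS : partial_green N.+1 y @[N --> \oo] --> green R nb o y.
  by rewrite (cvg_shiftS (partial_green ^~ y)); exact: cvg_partial_green.
apply: (cvg_unique _ cS) => //.
rewrite (funext (partial_greenS ^~ y)).
apply: cvgD; first exact: cvg_cst.
apply: cvg_big => [|x _]; [exact: add_continuous | apply: cvgM]; last exact: cvg_cst.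
exact: cvg_partial_green.
Qed.

Lemma mean_green x :
  mean nb (fun z => green R nb o z / (deg nb z)%:R) x
  - green R nb o x / (deg nb x)%:R + (deg nb o)%:R^-1 * (x == o)%:R = 0.
Proof.
rewrite [X in _ - X / _]green_eq /mean.
have -> : (deg nb o)%:R^-1 * (x == o)%:R = (deg nb x)%:R^-1 * (x == o)%:R :> R.
  by case: eqP => [->|_]; rewrite ?mulr0.
by ring.
Qed.

(** Decomposition at the last visit to [o] before time [t.+1], which takes place at time [t - s]. *)
Lemma srw_last_exit t y : srw R nb o t.+1 y =
  \sum_(0 <= s < t.+1) taboo R nb o s.+1 y * srw R nb o (t - s) o.
Proof.
elim: t y => [|t IH] y.
  by rewrite big_nat1 /= eqxx mulr1.
rewrite big_nat_recl //=.
(* Split on the vertex before [y]: [o] gives the term [s = 0], any other vertex is handled by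
   induction. *)
rewrite [LHS]/= (bigID (pred1 o)) /=; congr (_ + _).
  rewrite mulr_suml [RHS](bigID (pred1 o)) /= [X in _ + X]big1 ?addr0.
    by apply: eq_bigr => x /eqP ->; rewrite eqxx mulrAC mul1r mulrC.
  by move=> x /negPf ->; rewrite !mul0r.
under [RHS]eq_bigr => s _ do rewrite subSS mulr_suml.
rewrite exchange_big /=; apply: eq_bigr => x _.
rewrite -[X in X / _ = _]/(srw R nb o t.+1 x) IH mulr_suml.
by apply: eq_bigr => s _; rewrite mulrAC.
Qed.

(** The renewal equation, obtained by summing the last-exit decomposition at [y = o] over time. *)
Lemma partial_green_renewal N : partial_green N.+1 o =
  1 + \sum_(0 <= s < N) taboo R nb o s.+1 o * partial_green (N - s) o.
Proof.
elim: N => [|N IH].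
  by rewrite /partial_green big_nat1 big_geq //= eqxx addr0.
rewrite {1}/partial_green big_nat_recr //= -/(partial_green N.+1 o) IH.
rewrite -[\sum_(x <- nb o) _]/(srw R nb o N.+1 o) srw_last_exit -addrA.
congr (_ + _); rewrite [RHS]big_nat_recr //= [in LHS](big_nat_recr _ _ _ (leq0n N)) /=.
rewrite addrA -big_split /=; congr (_ + _).
  rewrite !big_nat; apply: eq_bigr => s /andP[_ sN].
  by rewrite -mulrDr subSn ?(ltnW sN) // [in RHS]/partial_green big_nat_recr.
by rewrite subSnn subnn [in RHS]/partial_green big_nat1.
Qed.

Lemma partial_green_ge1 N : 1 <= partial_green N.+1 o.
Proof.
rewrite partial_green_renewal lerDl; apply: sumr_ge0 => s _.
by rewrite mulr_ge0 ?taboo_ge0 ?partial_green_ge0.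
Qed.

Lemma partial_green_le_green N : partial_green N o <= green R nb o o.
Proof.
exact: (nondecreasing_cvgn_le (@partial_green_nd o) (@cvg_partial_green o)).
Qed.

Lemma green_gt0 : 0 < green R nb o o.
Proof.
exact: lt_le_trans ltr01 (le_trans (partial_green_ge1 0) (partial_green_le_green 1)).
Qed.

(** The return probability is squeezed to [(G - 1) / G], where [G] is the Green function at [o]. *)
Lemma escape_probE : escape_prob R nb o = (green R nb o o)^-1.
Proof.
pose F N : R := \sum_(1 <= t < N) taboo R nb o t o.
have FS N : F N.+1 = \sum_(0 <= s < N) taboo R nb o s.+1 o by rewrite /F big_add1.
have U_gt0 N : 0 < partial_green N.+1 o := lt_le_trans ltr01 (partial_green_ge1 N).
have lower N : (partial_green N.+2 o - 1) / partial_green N.+1 o <= F N.+2.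
  rewrite ler_pdivrMr // partial_green_renewal addrAC subrr add0r FS mulr_suml.
  apply: ler_sum => s _; rewrite ler_wpM2l ?taboo_ge0 //.
  by apply: partial_green_nd; exact: leq_subr.
have upper N : F N.+2 <= (green R nb o o - 1) / partial_green N.+1 o.
  rewrite ler_pdivlMr // lerBrDl.
  (* With the doubled horizon, each of the first [N.+1] renewal terms has a Green factor truncated
     at [N.+1] or later. *)
  apply: le_trans (partial_green_le_green (N.+1 + N.+1).+1).
  rewrite (partial_green_renewal (N.+1 + N.+1)) lerD2l FS mulr_suml.
  rewrite (@big_cat_nat _ _ _ N.+1 0 (N.+1 + N.+1)) // ?leq_addr //.
  rewrite -[leLHS]addr0 lerD //; last first.
    by apply: sumr_ge0 => s _; rewrite mulr_ge0 ?taboo_ge0 ?partial_green_ge0.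
  rewrite !big_nat; apply: ler_sum => s /andP[_ sN].
  rewrite ler_wpM2l ?taboo_ge0 //; apply: partial_green_nd.
  by rewrite -addnBA ?leq_addr // ltnW.
have U_cvg k : partial_green (N + k)%N o @[N --> \oo] --> green R nb o o.
  by rewrite (cvg_shiftn k (partial_green ^~ o)); exact: cvg_partial_green.
have U_neq0 : green R nb o o != 0 by rewrite gt_eqF // green_gt0.
have F_cvg : F N @[N --> \oo] --> (green R nb o o - 1) / green R nb o o.
  rewrite -(cvg_shiftn 2); apply: squeeze_cvgr; last 2 first.
  - apply: cvgM; last exact: (cvgV U_neq0 (U_cvg 1%N)).
    by apply: cvgB; [exact: (U_cvg 2%N) | exact: cvg_cst].
  - by apply: cvgM; [exact: cvg_cst | exact: (cvgV U_neq0 (U_cvg 1%N))].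
  by near=> N; rewrite !fctE /= !addn2 addn1 lower upper.
rewrite /escape_prob (cvg_lim _ F_cvg) //; field.
exact: U_neq0.
Unshelve. all: by end_near. Qed.

End GreenFunction.

(** * Squeezing the proportion of non-returning particles *)

Theorem theorem1p1 (R : realType) (V : eqType) (nb : V -> seq V) (o : V)
  (m : V -> V -> V) (rho_min : V -> V) :
  simple_graph nb -> connected_graph nb -> transient R nb o ->
  rotor_mechanism nb m -> rotor_config nb rho_min ->
  (forall x y, y \in nb x ->
     weight R nb o m x (rho_min x) <= weight R nb o m x y) ->
  (fun n : nat => (I_count o m rho_min n)%:R / n%:R : R) @ \oo
    --> escape_prob R nb o.
Proof.
move=> simp conn trans mech conf rho_min_le.
have deg_gt0 x : (0 < deg nb x)%N by rewrite /deg; case: (nb x) (conf x).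
have degR_gt0 : 0 < (deg nb o)%:R :> R by rewrite ltr0n.
pose I n : R := (I_count o m rho_min n)%:R.
have G_gt0 := green_gt0 simp deg_gt0 conn trans.
rewrite (escape_probE simp deg_gt0 conn trans).
have lower n : (0 < n)%N -> (green R nb o o)^-1 <= I n / n%:R.
  move=> n0; rewrite ler_pdivlMr ?ltr0n // mulrC ler_pdivrMr //.
  (* Division by the degree of [o] brings out [c = 1 / deg o] and [f o = green o / deg o]. *)
  rewrite -(ler_pM2r (x := (deg nb o)%:R^-1)) ?invr_gt0 // -mulrA.
  apply: (I_count_ge simp mech conf n0
    (f := fun x => green R nb o x / (deg nb x)%:R)) => [x|x|x y yx].
  - by rewrite divr_ge0 // green_ge0.
  - exact: mean_green.
  - have := rho_min_le x y yx; rewrite /weight /rotor_weight.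
    by under eq_bigr do rewrite -mulrA; under [in leRHS]eq_bigr do rewrite -mulrA.
(* [C] depends on [N] only, so [N] can be fixed before [n] grows. The index [N.+1] keeps the
   truncation at [o] at least 1. *)
have upper N : exists C : R, forall n, (0 < n)%N ->
    I n / n%:R <= (partial_green nb o N.+1 o)^-1 + C / n%:R.
  have [D DP] := @partial_green_finite_support R _ nb o simp N.+1.
  pose f x : R := partial_green nb o N.+1 x / (deg nb x)%:R.
  pose C := \sum_(x <- undup (flatten [seq nb z | z <- D])) weight_bound nb m f x.
  exists (C * (deg nb o)%:R / partial_green nb o N.+1 o) => n n0.
  have U_gt0 : 0 < partial_green nb o N.+1 o :> R.
    exact: lt_le_trans ltr01 (partial_green_ge1 nb o N).
  have fD z : z \notin D -> f z = 0 by move=> zD; rewrite /f DP ?mul0r.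
  have sub x : 0 <= mean nb f x - f x + (deg nb o)%:R^-1 * (x == o)%:R.
    by rewrite /f mean_partial_green // divr_ge0 // srw_ge0.
  have c_ge0 : 0 <= (deg nb o)%:R^-1 :> R by rewrite invr_ge0.
  have := I_count_le simp mech conf n0 conn c_ge0 fD sub.
  rewrite -/C /f mulrA -/(I n) => le.
  rewrite ler_pdivrMr ?ltr0n // mulrDl divfK ?gt_eqF ?ltr0n //.
  rewrite -(ler_pM2r U_gt0) mulrDl divfK ?gt_eqF // mulrAC mulVf ?gt_eqF // mul1r.
  rewrite -(ler_pM2r (x := (deg nb o)%:R^-1)) ?invr_gt0 // mulrDl.
  by rewrite mulfK ?gt_eqF.
apply/cvgrPdist_le => e e0.
have e2 : 0 < e / 2 by rewrite divr_gt0.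
have [N NP] : exists N, (partial_green nb o N.+1 o)^-1 < (green R nb o o)^-1 + e / 2.
  have cV : (partial_green nb o (N + 1) o)^-1 @[N --> \oo] --> (green R nb o o)^-1.
    apply: cvgV; first by rewrite gt_eqF.
    rewrite (cvg_shiftn 1 (fun N => partial_green nb o N o)).
    exact: cvg_partial_green.
  have [|N] := filter_ex (cvgr_lt _ cV ((green R nb o o)^-1 + e / 2) _).
    by rewrite ltrDl.
  by rewrite addn1; exists N.
have [C CP] := upper N.
near=> n.
have n0 : (0 < n)%N by near: n; exact: nbhs_infty_ge.
have Cn : C / n%:R <= e / 2.
  rewrite ler_pdivrMr ?ltr0n // mulrC -ler_pdivrMr //.
  by near: n; exact: nbhs_infty_ger.
have := lower n n0; have := CP n n0; rewrite -/(I n) ler_distl.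
by move=> *; apply/andP; split; lra.
Unshelve. all: by end_near. Qed.
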